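(* Let $c>1$ be a real number and let $n\ge 0$ be an integer. Then all the coefficients of the Laurent polynomial $R_n(c;x)$ are non-negative. Indeed, the coefficients of $x^n,x^{n-2},\dots,x^{-n+2},x^{-n}$ are positive, while all other coefficients are zero. The same is true of $S_n(c;x)$ in place of $R_n(c;x)$.
   Context: $T_n$ and $U_n$ are the Chebyshev polynomials of the first and second kind: $T_0(x)=1$, $T_1(x)=x$, $U_0(x)=1$, $U_1(x)=2x$, and both satisfy $f_{n+1}(x)=2xf_n(x)-f_{n-1}(x)$. In one variable $x$, $$R_n(c;x)=T_n\left(\frac{c}{2}\left(x+\frac1x\right)\right),\qquad S_n(c;x)=U_n\left(\frac{c}{2}\left(x+\frac1x\right)\right).$$ *)

(* Defs.v *)
From HB Require Import structures.
From mathcomp Require Import all_boot all_order all_algebra.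
From mathcomp Require Import finmap monalg.
From mathcomp Require Import reals.

Set Implicit Arguments.
Unset Strict Implicit.
Unset Printing Implicit Defensive.

Import Order.TTheory GRing.Theory Num.Theory.

Local Open Scope fset_scope.
Local Open Scope ring_scope.

(* The ring of Laurent polynomials R[x, 1/x], i.e. the group algebra of the
   additive group int. The additive structure and the coefficients [f@_k] are
   those of monalg; the product of monalg is not available because monomType
   requires [x * y = 1 -> x = 1 /\ y = 1], which fails for exponents in int. *)
Definition laurent (R : comNzRingType) := {malg R[int]}.

Section LaurentRing.
Variable R : comNzRingType.
Implicit Types (f g h : {malg R[int]}) (k : int).

HB.instance Definition _ := GRing.Lmodule.copy (laurent R) {malg R[int]}.

Definition laurent_mul f g : {malg R[int]} :=
  \sum_(k1 <- msupp f) \sum_(k2 <- msupp g)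
    << f@_k1 * g@_k2 *g (k1 + k2)%R >>.

Definition laurent_one : {malg R[int]} := << 1 *g 0%R >>.

Lemma laurent_mulw (d1 d2 : {fset int}) f g :
  msupp f `<=` d1 -> msupp g `<=` d2 ->
  laurent_mul f g = \sum_(k1 <- d1) \sum_(k2 <- d2)
    << f@_k1 * g@_k2 *g (k1 + k2)%R >>.
Proof.
move=> le_d1 le_d2; rewrite /laurent_mul (big_fset_incl _ le_d1) /=.
  apply/eq_bigr=> k1 _; apply/big_fset_incl => // k _ /mcoeff_outdom ->.
  by rewrite mulr0 monalgU0.
move=> k _ /mcoeff_outdom fk.
by rewrite big1 // => k' _; rewrite fk mul0r monalgU0.
Qed.

Lemma laurent_mulC : commutative laurent_mul.
Proof.
move=> f g; rewrite /laurent_mul exchange_big /=.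
by apply: eq_bigr => i _; apply: eq_bigr => j _; rewrite mulrC addrC.
Qed.

Lemma laurent_mulUg c k g :
  laurent_mul << c *g k >> g =
  \sum_(k' <- msupp g) << c * g@_k' *g (k + k')%R >>.
Proof.
rewrite (laurent_mulw msuppU_le (fsubset_refl _)) big_seq_fset1.
by apply/eq_bigr => k' _; rewrite mcoeffUU.
Qed.

Lemma laurent_mulUU c1 c2 k1 k2 :
  laurent_mul << c1 *g k1 >> << c2 *g k2 >> = << c1 * c2 *g (k1 + k2)%R >>.
Proof. by rewrite (laurent_mulw msuppU_le msuppU_le) !big_seq_fset1 !mcoeffUU. Qed.

Lemma laurent_mul1 : left_id laurent_one laurent_mul.
Proof.
move=> g; rewrite laurent_mulUg [RHS]monalgE.
by apply/eq_bigr=> k _; rewrite mul1r add0r.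
Qed.

Lemma laurent_mulDl : left_distributive laurent_mul +%R.
Proof.
move=> g1 g2 g.
rewrite [in RHS](laurent_mulw (fsubsetUl _ (msupp g2)) (fsubset_refl _)).
rewrite [in RHS](laurent_mulw (fsubsetUr (msupp g1) _) (fsubset_refl _)).
rewrite (laurent_mulw (msuppD_le _ _) (fsubset_refl _)).
rewrite -big_split /=; apply/eq_bigr=> k1 _.
rewrite -big_split /=; apply/eq_bigr=> k2 _.
by rewrite mcoeffD mulrDl monalgUD.
Qed.

Lemma laurent_mul0 : left_zero 0 laurent_mul.
Proof. by move=> g; rewrite /laurent_mul msupp0 big_seq_fset0. Qed.

Lemma laurent_mulA : associative laurent_mul.
Proof.
have suml (s : seq int) F g : laurent_mul (\sum_(k <- s) F k) g =
    \sum_(k <- s) laurent_mul (F k) g.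
  exact: (big_morph (laurent_mul^~ g) (fun _ _ => laurent_mulDl _ _ _)
                    (laurent_mul0 g)).
have sumr (s : seq int) F g : laurent_mul g (\sum_(k <- s) F k) =
    \sum_(k <- s) laurent_mul g (F k).
  by rewrite laurent_mulC suml; apply: eq_bigr => k _; rewrite laurent_mulC.
move=> f g h; rewrite [f]monalgE [g]monalgE [h]monalgE.
set F := (X in \sum_(k <- msupp f) X k); set G := (X in \sum_(k <- msupp g) X k).
set H := (X in \sum_(k <- msupp h) X k).
rewrite (suml _ F) (suml _ F) (suml _ (fun k => laurent_mul (F k) _)).
apply: eq_bigr => i _; rewrite (suml _ G) (sumr _ G).
rewrite (sumr _ (fun k => laurent_mul (G k) _)).
rewrite (suml _ (fun k => laurent_mul _ (G k))).
apply: eq_bigr => j _; rewrite !(sumr _ H) (sumr _ (fun k => laurent_mul _ (H k))).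
apply: eq_bigr => k _; rewrite /F /G /H.
by rewrite !laurent_mulUU mulrA addrA.
Qed.

Lemma laurent_one_neq0 : laurent_one != 0.
Proof. by rewrite monalgU_eq0 oner_eq0. Qed.

HB.instance Definition _ := GRing.Zmodule_isComNzRing.Build (laurent R)
  laurent_mulA laurent_mulC laurent_mul1 laurent_mulDl laurent_one_neq0.

Lemma laurent_scaleAl (c : R) (f g : laurent R) : c *: (f * g) = (c *: f) * g.
Proof.
have ZE (u : laurent R) : c *: u = laurent_mul << c *g 0%R >> u.
  by rewrite laurent_mulUg; apply: eq_bigr => k _; rewrite add0r.
by rewrite !ZE; exact: laurent_mulA.
Qed.

HB.instance Definition _ :=
  GRing.Lmodule_isLalgebra.Build R (laurent R) laurent_scaleAl.
HB.instance Definition _ := GRing.Lalgebra_isComAlgebra.Build R (laurent R).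

Definition laurentX : laurent R := << 1 *g 1%R >>.
Definition laurentXV : laurent R := << 1 *g (-1)%R >>.

Lemma laurentXK : laurentX * laurentXV = 1.
Proof. by rewrite [LHS]laurent_mulUU mulr1. Qed.

Lemma mcoeff_laurentM f g k :
  ((f : laurent R) * (g : laurent R) : laurent R)@_k =
  \sum_(i <- msupp f) f@_i * g@_(k - i)%R.
Proof.
rewrite [_ * _]/(laurent_mul f g) raddf_sum; apply: eq_bigr => i _.
rewrite raddf_sum /=; have [ki|ki] := boolP (k - i \in msupp g).
  rewrite (big_fsetD1 _ ki) /= mcoeffU subrKC eqxx.
  rewrite big1_fset ?addr0 // => j; rewrite in_fsetD1 => /andP[nj _] _.
  rewrite mcoeffU; case: eqP => // ijk.
  by case/eqP: nj; rewrite -ijk addrAC subrr add0r.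
rewrite [g@_(k - i)%R]mcoeff_outdom // mulr0 big1_fset // => j gj _.
rewrite mcoeffU; case: eqP => // ijk; case/negP: ki.
by rewrite -ijk addrAC subrr add0r.
Qed.

End LaurentRing.

Section Chebyshev.
Variable R : comNzRingType.

Fixpoint chebyshevT (n : nat) : {poly R} :=
  match n with
  | 0 => 1
  | 1 => 'X
  | (m.+1 as p).+1 => 2 * 'X * chebyshevT p - chebyshevT m
  end.

Fixpoint chebyshevU (n : nat) : {poly R} :=
  match n with
  | 0 => 1
  | 1 => 2 * 'X
  | (m.+1 as p).+1 => 2 * 'X * chebyshevU p - chebyshevU m
  end.

End Chebyshev.

Definition laurentR (F : fieldType) (n : nat) (c : F) : laurent F :=
  horner_alg ((c / 2) *: (laurentX F + laurentXV F)) (chebyshevT F n).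

Definition laurentS (F : fieldType) (n : nat) (c : F) : laurent F :=
  horner_alg ((c / 2) *: (laurentX F + laurentXV F)) (chebyshevU F n).

(* Main.v *)
Require Import Defs.
From HB Require Import structures.
From mathcomp Require Import all_boot all_order all_algebra.
From mathcomp Require Import finmap monalg.
From mathcomp Require Import reals.
From mathcomp Require Import zify ring lra.

Import Order.TTheory GRing.Theory Num.Theory.

Local Open Scope ring_scope.

(** Write [a n k] for the coefficient of x^k. Both families satisfy
    a(n+2,k) = c (a(n+1,k-1) + a(n+1,k+1)) - a(n,k), with a(0,.) = [k = 0] and
    a(1,.) = w [k = 1 or k = -1], where w = c/2 for R_n and w = c for S_n.
    The defect D(n,k) = c a(n,k-1) - a(n-1,k) satisfies
    a(n+1,k) = c a(n,k+1) + D(n,k) and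
    D(n+1,k) = (c^2 - 1) a(n,k) + c D(n,k-1),
    so nonnegativity of D and of the coefficients propagate together. For R_n
    this breaks at D(1,0) = c^2/2 - 1, which may be negative; but D(n+1,k) only
    depends on D(n,k-1), so D(n,k) >= 0 for k <= 0 and n >= 2, and the symmetry
    k -> -k takes care of positive k. *)

(** * Support, symmetry and sign of solutions of the recurrence *)

Section ChebyshevRecurrence.
Variables (R : realFieldType) (c w : R) (a : nat -> int -> R).
Hypothesis a0 : forall k, a 0 k = (k == 0)%:R.
Hypothesis a1 : forall k, a 1 k = w * ((k == 1)%:R + (k == -1)%:R).
Hypothesis aSS : forall n k,
  a n.+2 k = c * (a n.+1 (k - 1) + a n.+1 (k + 1)) - a n k.

Lemma cheb_coefN n k : a n (- k) = a n k.
Proof.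
suff: (forall k, a n (- k) = a n k) /\ (forall k, a n.+1 (- k) = a n.+1 k).
  by case.
elim: n {k} => [|n [IH IH1]]; split=> // k.
- by rewrite !a0 oppr_eq0.
- by rewrite !a1 eqr_opp eqr_oppLR addrC.
- rewrite !aSS IH -(IH1 (k - 1)) -(IH1 (k + 1)) !opprD opprK.
  by rewrite [a _ _ + a _ _]addrC.
Qed.

Lemma cheb_coef_eq0 n (k : int) :
  (forall j : nat, (j <= n)%N -> k <> n%:Z - 2 * j%:Z) -> a n k = 0.
Proof.
suff: (forall k : int, (forall j : nat, (j <= n)%N -> k <> n%:Z - 2 * j%:Z) ->
         a n k = 0)
  /\ (forall k : int,
         (forall j : nat, (j <= n.+1)%N -> k <> n.+1%:Z - 2 * j%:Z) ->
         a n.+1 k = 0).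
  by case=> + _; apply.
elim: n {k} => [|n [IH IH1]]; split=> // k Hk.
- by rewrite a0; case: eqP => // k0; have := Hk 0 isT; lia.
- rewrite a1; have := Hk 0 isT; have := Hk 1 isT => h1 h0.
  by case: eqP => [|_]; [lia|case: eqP => [|_]; [lia|rewrite addr0 mulr0]].
(* All three terms vanish: if [k], [k - 1] or [k + 1] were an exponent of its level with index [j],
   then [k] would be one of level [n.+2], with index [j.+1], [j] or [j.+1] respectively. *)
- rewrite aSS IH ?IH1 ?addr0 ?mulr0 ?subrr // => j jn e.
  + by apply: (Hk j.+1); lia.
  + by apply: (Hk j); lia.
  + by apply: (Hk j.+1); lia.
Qed.

(** Off the exponents [n - 2j] the coefficient vanishes. Positivity is a premise so that the lemma
    can serve inside the induction that establishes it. *)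
Lemma cheb_coef_ge0 n :
  (forall j : nat, (j <= n)%N -> 0 < a n (n%:Z - 2 * j%:Z)) ->
  forall k, 0 <= a n k.
Proof.
move=> pos k.
have [/existsP[j /eqP->]|/existsPn H] :=
  boolP [exists j : 'I_n.+1, k == n%:Z - 2 * (j : nat)%:Z].
  by apply/ltW/pos; rewrite -ltnS.
rewrite cheb_coef_eq0 // => j jn; apply/eqP.
exact: H (Ordinal (jn : (j < n.+1)%N)).
Qed.

(** Only [a n.+2 (k - 1)] is expanded; its upper neighbour [k] contributes [c ^+ 2 * a n.+1 k]. *)
Lemma cheb_defectS n k :
  c * a n.+2 (k - 1) - a n.+1 k =
  (c ^+ 2 - 1) * a n.+1 k + c * (c * a n.+1 (k - 1 - 1) - a n (k - 1)).
Proof. by rewrite aSS subrK; ring. Qed.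

Hypotheses (c_gt1 : 1 < c) (w_gt0 : 0 < w) (cw_gt1 : 1 < 2 * c * w).

Lemma cheb_coef_gt0 n j : (j <= n)%N -> 0 < a n (n%:Z - 2 * j%:Z).
Proof.
pose pos m := forall j : nat, (j <= m)%N -> 0 < a m (m%:Z - 2 * j%:Z).
(* The defect enters the invariant only from level 2 on and for [k <= 0], the range stable under
   [k -> k - 1]. *)
suff main m : [/\ pos m.+1, pos m.+2
    & forall k, k <= 0 -> 0 <= c * a m.+2 (k - 1) - a m.+1 k].
  case: n => [|n]; last by case: (main n) => + _ _; apply.
  by rewrite leqn0 => /eqP->; rewrite a0 ltr01.
have c_gt0 : 0 < c by apply: lt_trans c_gt1.
have c2 : 0 <= c ^+ 2 - 1 by rewrite subr_ge0 exprn_ege1 // ltW.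
have cw : 0 < c * w by rewrite mulr_gt0.
elim: m => [|m [pos1 pos2 D]]; last first.
  split=> // [i ile|k k0]; last first.
    rewrite cheb_defectS addr_ge0 ?mulr_ge0 ?(ltW c_gt0) ?D //; last by lia.
    exact: cheb_coef_ge0.
  (* Here [k + 1] is the exponent of index [i'] at level [m.+2], so [c * a m.+2 (k + 1)] is positive
     and the defect added to it is nonnegative. *)
  have step k i' : k <= 0 -> (i' <= m.+2)%N -> k = m.+1%:Z - 2 * i'%:Z ->
      0 < a m.+3 k.
    move=> k0 i'le ek.
    have -> : a m.+3 k = c * a m.+2 (k + 1) + (c * a m.+2 (k - 1) - a m.+1 k).
      by rewrite aSS; ring.
    rewrite ltr_pwDl ?D // mulr_gt0 //.
    by have := pos2 _ i'le; congr (0 < a _ _); lia.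
  (* In the form [m.+1 - 2i'], the exponent has [i' = i - 1], and its negative has
     [i' = m.+2 - i]. *)
  have [k0|k0] := lerP (m.+3%:Z - 2 * i%:Z) 0.
    by apply: (step _ i.-1) => //; lia.
  by rewrite -cheb_coefN; apply: (step _ (m.+2 - i)%N); lia.
have pos1 : pos 1.
  by case=> [|[|//]] _; rewrite a1 /= ?addr0 ?add0r mulr1.
split=> // [|k k0].
  (* This is the constant coefficient at level 2, the source of the hypothesis [cw_gt1]. *)
  have cw2 : c * (w + w) - 1 = 2 * c * w - 1 by ring.
  case=> [|[|[|//]]] _; rewrite aSS !a1 a0 /= ?addr0 ?add0r ?mulr1 ?mulr0.
  - by rewrite ?addr0 ?add0r subr0.
  - by rewrite cw2 subr_gt0.
  - by rewrite ?addr0 ?add0r subr0.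
rewrite cheb_defectS addr_ge0 ?mulr_ge0 ?(ltW c_gt0) ?cheb_coef_ge0 //.
(* The only possibly negative term, [- a 0 (k - 1)], lives at [k = 1], which [k <= 0] excludes. *)
rewrite a0 (_ : (k - 1 == 0) = false); last by apply/eqP; lia.
by rewrite subr0 mulr_ge0 ?(ltW c_gt0) ?cheb_coef_ge0.
Qed.

End ChebyshevRecurrence.

(** * The coefficient recurrences of [laurentR] and [laurentS] *)

Section LaurentChebyshev.
Variables (F : fieldType) (c : F).
Hypothesis two_neq0 : 2 != 0 :> F.
Implicit Types (f : laurent F) (k : int).

Lemma mcoeff_laurentUM (i k : int) f :
  ((<< 1 *g i >> : laurent F) * f : laurent F)@_k = f@_(k - i).
Proof.
by rewrite mcoeff_laurentM msuppU oner_eq0 big_seq_fset1 mcoeffUU mul1r.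
Qed.

Lemma mcoeff_laurentXDM k f :
  ((laurentX F + laurentXV F) * f : laurent F)@_k = f@_(k - 1) + f@_(k + 1).
Proof. by rewrite mulrDl mcoeffD !mcoeff_laurentUM opprK. Qed.

Lemma mcoeff_laurentXD k :
  (laurentX F + laurentXV F : laurent F)@_k = (k == 1)%:R + (k == -1)%:R.
Proof. by rewrite mcoeffD !mcoeffU ![_ == k]eq_sym. Qed.

Lemma mcoeff_laurent1 k : (1 : laurent F)@_k = (k == 0)%:R.
Proof. by rewrite [1](_ : _ = laurent_one F) // mcoeffU eq_sym. Qed.

Let z : laurent F := (c / 2) *: (laurentX F + laurentXV F).

(** The 2 of the Chebyshev recurrence cancels the denominator in [z]. Arbitrary [p] and [q] cover
    both families at once. *)
Lemma horner_alg_2XM (p q : {poly F}) :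
  horner_alg z (2 * 'X * p - q) =
  c *: (laurentX F + laurentXV F) * horner_alg z p - horner_alg z q.
Proof.
have -> : c *: (laurentX F + laurentXV F) = 2 * z.
  by rewrite mulr_natl -scaler_nat scalerA mulrC divfK.
by rewrite rmorphB !rmorphM /= rmorph_nat horner_algX.
Qed.

Lemma mcoeff_horner_algSS (p q : {poly F}) k :
  (horner_alg z (2 * 'X * p - q) : laurent F)@_k =
  c * ((horner_alg z p : laurent F)@_(k - 1)
       + (horner_alg z p : laurent F)@_(k + 1))
  - (horner_alg z q : laurent F)@_k.
Proof.
by rewrite horner_alg_2XM -scalerAl mcoeffB mcoeffZ mcoeff_laurentXDM.
Qed.

Lemma mcoeff_laurentR0 k : (laurentR 0 c)@_k = (k == 0)%:R.
Proof. by rewrite /laurentR rmorph1 mcoeff_laurent1. Qed.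

Lemma mcoeff_laurentR1 k :
  (laurentR 1 c)@_k = c / 2 * ((k == 1)%:R + (k == -1)%:R).
Proof. by rewrite /laurentR horner_algX mcoeffZ mcoeff_laurentXD. Qed.

Lemma mcoeff_laurentRSS n k : (laurentR n.+2 c)@_k =
  c * ((laurentR n.+1 c)@_(k - 1) + (laurentR n.+1 c)@_(k + 1))
  - (laurentR n c)@_k.
Proof. exact: mcoeff_horner_algSS. Qed.

Lemma mcoeff_laurentS0 k : (laurentS 0 c)@_k = (k == 0)%:R.
Proof. by rewrite /laurentS rmorph1 mcoeff_laurent1. Qed.

Lemma mcoeff_laurentS1 k :
  (laurentS 1 c)@_k = c * ((k == 1)%:R + (k == -1)%:R).
Proof.
rewrite /laurentS rmorphM /= rmorph_nat horner_algX mulr_natl -scaler_nat.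
by rewrite scalerA mulrC divfK // mcoeffZ mcoeff_laurentXD.
Qed.

Lemma mcoeff_laurentSSS n k : (laurentS n.+2 c)@_k =
  c * ((laurentS n.+1 c)@_(k - 1) + (laurentS n.+1 c)@_(k + 1))
  - (laurentS n c)@_k.
Proof. exact: mcoeff_horner_algSS. Qed.

End LaurentChebyshev.

Theorem theorem4p1 (R : realType) (c : R) (hc : 1 < c) (n : nat) :
  [/\ forall k : int, 0 <= (laurentR n c)@_k,
      forall j : nat, (j <= n)%N -> 0 < (laurentR n c)@_(n%:Z - 2 * j%:Z)
    & forall k : int, (forall j : nat, (j <= n)%N -> k <> n%:Z - 2 * j%:Z) ->
        (laurentR n c)@_k = 0]
  /\
  [/\ forall k : int, 0 <= (laurentS n c)@_k,
      forall j : nat, (j <= n)%N -> 0 < (laurentS n c)@_(n%:Z - 2 * j%:Z)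
    & forall k : int, (forall j : nat, (j <= n)%N -> k <> n%:Z - 2 * j%:Z) ->
        (laurentS n c)@_k = 0].

Proof.
have two0 : 2 != 0 :> R by rewrite pnatr_eq0.
have c0 : 0 < c by apply: lt_trans hc.
have cc : 1 < c * c by rewrite -expr2 exprn_egt1.
pose T m k : R := (laurentR m c)@_k; pose U m k : R := (laurentS m c)@_k.
have T0 k : T 0 k = (k == 0)%:R by exact: mcoeff_laurentR0.
have T1 k : T 1 k = c / 2 * ((k == 1)%:R + (k == -1)%:R).
  exact: mcoeff_laurentR1.
have TSS m k : T m.+2 k = c * (T m.+1 (k - 1) + T m.+1 (k + 1)) - T m k.
  exact: mcoeff_laurentRSS.
have U0 k : U 0 k = (k == 0)%:R by exact: mcoeff_laurentS0.
have U1 k : U 1 k = c * ((k == 1)%:R + (k == -1)%:R).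
  exact: mcoeff_laurentS1.
have USS m k : U m.+2 k = c * (U m.+1 (k - 1) + U m.+1 (k + 1)) - U m k.
  exact: mcoeff_laurentSSS.
(* With [w = c / 2] the condition [1 < 2 * c * w] is exactly [cc]; with [w = c] it follows from
   [cc]. *)
have posT : forall j : nat, (j <= n)%N -> 0 < T n (n%:Z - 2 * j%:Z).
  by move=> j; apply: (cheb_coef_gt0 _ _ _ _ T0 T1 TSS hc); lra.
have posU : forall j : nat, (j <= n)%N -> 0 < U n (n%:Z - 2 * j%:Z).
  by move=> j; apply: (cheb_coef_gt0 _ _ _ _ U0 U1 USS hc); lra.
split; split; [|exact: posT| | |exact: posU|].
- exact: (cheb_coef_ge0 _ _ _ _ T0 T1 TSS n posT).
- by move=> k; apply: (cheb_coef_eq0 _ _ _ _ T0 T1 TSS).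
- exact: (cheb_coef_ge0 _ _ _ _ U0 U1 USS n posU).
- by move=> k; apply: (cheb_coef_eq0 _ _ _ _ U0 U1 USS).
Qed.
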